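(* Let $(x_n,y_n)_{n\ge 1}$ be the sequence enumerating $\mathcal{S}$ described in the context. Then $$\lim_{n\to\infty}\frac{y_n+1}{x_n+1}=\lim_{n\to\infty}\frac{y_n}{x_n}=\frac{1}{\sqrt{10}}.$$ Moreover, the sequence $y_n/x_n$ is strictly increasing and the sequence $(y_n+1)/(x_n+1)$ is strictly decreasing.
   Context: $\mathcal{S}=\{(x,y)\in\mathbb{Z}^2 : x>y\ge 1,\ x(x+1)=10\,y(y+1)\}$, regarded as the sequence $(x_n,y_n)_{n\ge1}$ given by $(x_1,y_1)=(4,1)$, $(x_2,y_2)=(20,6)$, $(x_3,y_3)=(39,12)$ and, for $n\ge 1$, $x_{n+3}=19x_n+60y_n+39$, $y_{n+3}=6x_n+19y_n+12$. *)

(* Defs.v *)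
(* Stdlib reals with Coquelicot. *)
From Stdlib Require Import Reals ZArith Lia Psatz.
From Coquelicot Require Import Coquelicot.

Open Scope Z_scope.

Definition in_S (p : Z * Z) : Prop :=
  let (x, y) := p in x > y /\ y >= 1 /\ x * (x + 1) = 10 * (y * (y + 1)).

(* Indices start at 1.  The recurrence also holds at 0 because of the value
   (0, 0), which is not an element of S; it gives the value (39, 12) at 3. *)
Fixpoint sol (n : nat) : Z * Z :=
  match n with
  | 0%nat => (0, 0)
  | 1%nat => (4, 1)
  | 2%nat => (20, 6)
  | S (S (S m)) =>
      let (x, y) := sol m in (19 * x + 60 * y + 39, 6 * x + 19 * y + 12)
  end.

Definition xs (n : nat) : Z := fst (sol n).
Definition ys (n : nat) : Z := snd (sol n).

Lemma sol_init : sol 1 = (4, 1) /\ sol 2 = (20, 6) /\ sol 3 = (39, 12).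
Proof. repeat split. Qed.

Lemma sol_rec (n : nat) :
  xs (n + 3) = 19 * xs n + 60 * ys n + 39 /\
  ys (n + 3) = 6 * xs n + 19 * ys n + 12.
Proof.
  replace (n + 3)%nat with (S (S (S n))) by lia.
  unfold xs, ys; cbn [sol]; destruct (sol n) as [x y]; simpl; lia.
Qed.

Lemma sol_three_step (P : nat -> Prop) :
  P 1%nat -> P 2%nat -> P 3%nat ->
  (forall n, (1 <= n)%nat -> P n -> P (n + 3)%nat) ->
  forall n, (1 <= n)%nat -> P n.
Proof.
  intros H1 H2 H3 Hs n; induction n as [n IH] using lt_wf_ind.
  intros Hn; destruct n as [|[|[|[|m]]]]; auto; try lia.
  replace (S (S (S (S m)))) with (S m + 3)%nat by lia.
  apply Hs; [lia|]; apply IH; lia.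
Qed.

Lemma sol_in_S (n : nat) : (1 <= n)%nat -> in_S (sol n).
Proof.
  revert n; apply sol_three_step; try (simpl; lia).
  intros n _; replace (n + 3)%nat with (S (S (S n))) by lia.
  cbn [sol]; destruct (sol n) as [x y]; unfold in_S; intros (H1 & H2 & H3).
  repeat split; lia.
Qed.

(* The sequence is increasing in both coordinates, hence without repetition. *)
Lemma sol_increasing (n : nat) :
  (1 <= n)%nat -> xs n < xs (S n) /\ ys n < ys (S n).
Proof.
  revert n; apply sol_three_step; try (vm_compute; split; reflexivity).
  intros n _; replace (S (n + 3))%nat with (S n + 3)%nat by lia.
  destruct (sol_rec n) as [-> ->]; destruct (sol_rec (S n)) as [-> ->]; lia.
Qed.

Lemma S_small (x y : Z) : in_S (x, y) -> y <= 12 ->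
  (x, y) = (4, 1) \/ (x, y) = (20, 6) \/ (x, y) = (39, 12).
Proof.
  intros (Hxy & Hy & E) Hs.
  assert (Hx : x <= 39) by nia.
  assert (Hb : y = 1 \/ y = 2 \/ y = 3 \/ y = 4 \/ y = 5 \/ y = 6 \/ y = 7 \/
    y = 8 \/ y = 9 \/ y = 10 \/ y = 11 \/ y = 12) by lia.
  assert (D : forall a, a * (a + 1) < 10 * (y * (y + 1)) -> a >= 0 -> a < x)
    by (intros; nia).
  assert (U : forall a, 10 * (y * (y + 1)) < a * (a + 1) -> a >= 0 -> x < a)
    by (intros; nia).
  destruct Hb as [->|[->|[->|[->|[->|[->|[->|[->|[->|[->|[->| ->]]]]]]]]]]].
  - pose proof (D 3); pose proof (U 5); left; f_equal; lia.
  - pose proof (D 7); pose proof (U 8); lia.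
  - pose proof (D 10); pose proof (U 11); lia.
  - pose proof (D 13); pose proof (U 14); lia.
  - pose proof (D 16); pose proof (U 17); lia.
  - pose proof (D 19); pose proof (U 21); right; left; f_equal; lia.
  - pose proof (D 23); pose proof (U 24); lia.
  - pose proof (D 26); pose proof (U 27); lia.
  - pose proof (D 29); pose proof (U 30); lia.
  - pose proof (D 32); pose proof (U 33); lia.
  - pose proof (D 35); pose proof (U 36); lia.
  - pose proof (D 38); pose proof (U 40); right; right; f_equal; lia.
Qed.

Lemma S_descent (x y : Z) : in_S (x, y) -> y > 12 ->
  in_S (19 * x - 60 * y - 21, - 6 * x + 19 * y + 6) /\
  - 6 * x + 19 * y + 6 < y.
Proof.
  intros (Hxy & Hy & E) Hb.
  assert (H1 : 6 * x <= 19 * y + 5) by nia.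
  assert (H2 : 3 * y + 1 < x) by nia.
  assert (H3 : 79 * y + 27 < 25 * x) by nia.
  unfold in_S; repeat split; lia.
Qed.

Theorem sol_enumerates_S (p : Z * Z) :
  in_S p <-> exists n : nat, (1 <= n)%nat /\ sol n = p.
Proof.
  split; [|intros (n & Hn & <-); now apply sol_in_S].
  destruct p as [x y]; intros Hp.
  assert (Hk : exists k, y < Z.of_nat k).
  { exists (Z.to_nat (y + 1)); destruct Hp as (_ & Hy & _); lia. }
  destruct Hk as [k Hk]; revert x y Hp Hk.
  induction k as [|k IH]; intros x y Hp Hk; [destruct Hp as (_ & Hy & _); lia|].
  destruct (Z_le_gt_dec y 12) as [Hs|Hs].
  - destruct (S_small x y Hp Hs) as [->|[->| ->]].
    + exists 1%nat; split; [lia | reflexivity].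
    + exists 2%nat; split; [lia | reflexivity].
    + exists 3%nat; split; [lia | reflexivity].
  - destruct (S_descent x y Hp Hs) as [Hq Hlt].
    destruct (IH _ _ Hq) as (n & Hn & En); [lia|].
    exists (S (S (S n))); split; [lia|].
    cbn [sol]; rewrite En; f_equal; ring.
Qed.

Open Scope R_scope.

(* Main.v *)
(* On S the equation x(x+1) = 10y(y+1) says that the two quotients y/x and
   (y+1)/(x+1) have product 1/10.  As y < x, the first is the smaller one, so
   they enclose 1/sqrt 10; their distance is less than 1/x, which tends to 0.
   Since the product is constant, one quotient increases exactly when the other
   decreases.  If y/x did not increase from (x,y) to (x',y'), then
   y x' >= y' x and (y+1)(x'+1) <= (y'+1)(x+1), hence x' - x <= y' - y,
   whereas x - y is increasing along the sequence. *)
Require Import Defs.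
From Stdlib Require Import Reals ZArith Lia Psatz.
From Coquelicot Require Import Coquelicot.

(** The recurrence turns [x - y] into [13 x + 41 y + 27], so three indices later the increment of
    [x - y] is 13 times that of [x] plus 41 times that of [y], both positive. *)
Lemma sol_diff_increasing (m n : nat) :
  (1 <= m)%nat -> (m < n)%nat -> (xs m - ys m < xs n - ys n)%Z.
Proof.
  assert (step : forall k, (1 <= k)%nat ->
    (xs k - ys k < xs (S k) - ys (S k))%Z).
  { apply sol_three_step; try (vm_compute; reflexivity).
    intros k Hk _; replace (S (k + 3)) with (S k + 3)%nat by lia.
    destruct (sol_increasing k Hk).
    destruct (sol_rec k) as [-> ->]; destruct (sol_rec (S k)) as [-> ->]; lia. }
  intros Hm Hmn; induction Hmn as [|n Hmn IH]; [now apply step|].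
  specialize (step n); lia.
Qed.

Lemma sol_IZR (n : nat) : (1 <= n)%nat ->
  1 <= IZR (ys n) /\ IZR (ys n) < IZR (xs n) /\
  IZR (xs n) * (IZR (xs n) + 1) = 10 * (IZR (ys n) * (IZR (ys n) + 1)).
Proof.
  intros Hn; generalize (sol_in_S n Hn).
  unfold xs, ys, in_S; destruct (sol n) as [x y]; cbn [fst snd].
  intros (H1 & H2 & H3).
  split; [apply IZR_le; lia|split; [apply IZR_lt; lia|]].
  apply (f_equal IZR) in H3.
  now rewrite !mult_IZR, !plus_IZR in H3.
Qed.

Lemma quotients_product (x y : R) : 0 < x ->
  x * (x + 1) = 10 * (y * (y + 1)) -> y / x * ((y + 1) / (x + 1)) = / 10.
Proof.
  intros Hx E.
  replace (y / x * ((y + 1) / (x + 1))) with (y * (y + 1) / (x * (x + 1)))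
    by (field; lra).
  rewrite E; field; nra.
Qed.

Lemma quotient_lt (x y x' y' : R) : 0 < y < x -> 0 < y' < x' ->
  x * (x + 1) = 10 * (y * (y + 1)) -> x' * (x' + 1) = 10 * (y' * (y' + 1)) ->
  x - y < x' - y' -> y / x < y' / x'.
Proof.
  intros H H' E E' D.
  apply Rnot_le_lt; intros Hle.
  assert (C1 : y' * x <= y * x').
  { apply Rmult_le_reg_r with (/ x * / x').
    - apply Rmult_lt_0_compat; apply Rinv_0_lt_compat; lra.
    - replace (y' * x * (/ x * / x')) with (y' / x') by (field; lra).
      replace (y * x' * (/ x * / x')) with (y / x) by (field; lra); exact Hle. }
  (* Equality of the two products of quotients, cleared of denominators. *)
  assert (P : y * x' * ((y + 1) * (x' + 1)) = y' * x * ((y' + 1) * (x + 1))).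
  { transitivity (y * (y + 1) * (x' * (x' + 1))); [ring|].
    rewrite E'.
    transitivity (y' * (y' + 1) * (x * (x + 1))); [rewrite E; ring|ring]. }
  (* By [P], enlarging [y' * x] to [y * x'] in the left factor must be paid for in the other factor;
     the positive [y' * x] is then cancelled. *)
  assert (C2 : (y + 1) * (x' + 1) <= (y' + 1) * (x + 1)).
  { apply Rmult_le_reg_l with (y' * x); [nra|].
    rewrite <- P; apply Rmult_le_compat_r; [nra|exact C1]. }
  (* Expanding [C2] and adding [C1] cancels the mixed products and leaves [x' + y <= x + y'],
     against [D]. *)
  lra.
Qed.

(** Two distinct positive numbers have their geometric mean strictly between them, and here it is
    the square root of 1/10. *)
Lemma quotients_enclose (x y : R) : 0 < y < x ->
  x * (x + 1) = 10 * (y * (y + 1)) ->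
  y / x < 1 / sqrt 10 < (y + 1) / (x + 1).
Proof.
  intros H E.
  assert (P := quotients_product x y ltac:(lra) E).
  assert (R0 : 0 < y / x) by (apply Rdiv_lt_0_compat; lra).
  assert (S0 : 0 < (y + 1) / (x + 1)) by (apply Rdiv_lt_0_compat; lra).
  assert (L : y / x < (y + 1) / (x + 1)).
  { apply Rlt_0_minus.
    replace ((y + 1) / (x + 1) - y / x) with ((x - y) / (x * (x + 1)))
      by (field; lra).
    apply Rdiv_lt_0_compat; nra. }
  assert (Q0 : 0 < sqrt 10) by (apply sqrt_lt_R0; lra).
  assert (T0 : 0 < 1 / sqrt 10) by (apply Rdiv_lt_0_compat; lra).
  assert (T : 1 / sqrt 10 * (1 / sqrt 10) = / 10).
  { replace (1 / sqrt 10 * (1 / sqrt 10)) with (/ (sqrt 10 * sqrt 10))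
      by (field; lra).
    rewrite sqrt_sqrt; lra. }
  split; nra.
Qed.

Lemma quotients_close (x y : R) : 0 < y < x ->
  (y + 1) / (x + 1) - y / x < / x.
Proof.
  intros H.
  replace ((y + 1) / (x + 1) - y / x) with (/ x - (y + 1) / (x * (x + 1)))
    by (field; lra).
  assert (0 < (y + 1) / (x * (x + 1))) by (apply Rdiv_lt_0_compat; nra).
  lra.
Qed.

Lemma is_lim_seq_inv_xs : is_lim_seq (fun n => / IZR (xs n)) 0.
Proof.
  (* A strictly increasing integer sequence outgrows its index. Since [sol_increasing] starts at 1,
     the bounds at 0 and 1 are computed directly. *)
  assert (B : forall n, (Z.of_nat n <= xs n)%Z).
  { induction n as [|[|n] IH]; [now vm_compute|now vm_compute|].
    pose proof (sol_increasing (S n) ltac:(lia)); lia. }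
  apply (is_lim_seq_inv _ p_infty); [|discriminate].
  apply is_lim_seq_le_p_loc with INR; [|apply is_lim_seq_INR].
  exists 0%nat; intros n _; rewrite INR_IZR_INZ; now apply IZR_le.
Qed.

Theorem proposition4 :
  is_lim_seq (fun n : nat => (IZR (ys n) + 1) / (IZR (xs n) + 1))
             (Finite (1 / sqrt 10)) /\
  is_lim_seq (fun n : nat => IZR (ys n) / IZR (xs n))
             (Finite (1 / sqrt 10)) /\
  (forall m n : nat, (1 <= m)%nat -> (m < n)%nat ->
     IZR (ys m) / IZR (xs m) < IZR (ys n) / IZR (xs n)) /\
  (forall m n : nat, (1 <= m)%nat -> (m < n)%nat ->
     (IZR (ys n) + 1) / (IZR (xs n) + 1) < (IZR (ys m) + 1) / (IZR (xs m) + 1)).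
Proof.
  set (l := 1 / sqrt 10).
  assert (Hl : is_lim_seq (fun _ => l) l) by apply is_lim_seq_const.
  assert (encl : forall n : nat, (1 <= n)%nat ->
     l - / IZR (xs n) < IZR (ys n) / IZR (xs n) < l /\
     l < (IZR (ys n) + 1) / (IZR (xs n) + 1) < l + / IZR (xs n)).
  { intros n Hn; destruct (sol_IZR n Hn) as (A & B & C).
    assert (H : 0 < IZR (ys n) < IZR (xs n)) by lra.
    pose proof (quotients_enclose _ _ H C) as E.
    pose proof (quotients_close _ _ H).
    fold l in E; lra. }
  assert (mono : forall m n : nat, (1 <= m)%nat -> (m < n)%nat ->
     IZR (ys m) / IZR (xs m) < IZR (ys n) / IZR (xs n)).
  { intros m n Hm Hmn.
    destruct (sol_IZR m Hm) as (A & B & C).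
    destruct (sol_IZR n ltac:(lia)) as (A' & B' & C').
    apply quotient_lt; try lra.
    rewrite <- !minus_IZR; now apply IZR_lt, sol_diff_increasing. }
  split; [|split; [|split; [exact mono|]]].
  - apply is_lim_seq_le_le_loc with (fun _ => l) (fun n => l + / IZR (xs n)).
    (* The enclosure is available from index 1 on, index 0 carrying the auxiliary pair (0, 0), so
       the squeeze is applied eventually. *)
    + exists 1%nat; intros n Hn; specialize (encl n Hn); lra.
    + exact Hl.
    + replace (Finite l) with (Finite (l + 0)) by (f_equal; ring).
      apply (is_lim_seq_plus' _ _ _ _ Hl is_lim_seq_inv_xs).
  - apply is_lim_seq_le_le_loc with (fun n => l - / IZR (xs n)) (fun _ => l).
    + exists 1%nat; intros n Hn; specialize (encl n Hn); lra.
    + replace (Finite l) with (Finite (l - 0)) by (f_equal; ring).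
      apply (is_lim_seq_minus' _ _ _ _ Hl is_lim_seq_inv_xs).
    + exact Hl.
  - intros m n Hm Hmn.
    destruct (sol_IZR m Hm) as (A & B & C).
    destruct (sol_IZR n ltac:(lia)) as (A' & B' & C').
    pose proof (quotients_product (IZR (xs m)) (IZR (ys m)) ltac:(lra) C).
    pose proof (quotients_product (IZR (xs n)) (IZR (ys n)) ltac:(lra) C').
    pose proof (mono m n Hm Hmn).
    assert (0 < IZR (ys m) / IZR (xs m)) by (apply Rdiv_lt_0_compat; lra).
    assert (0 < (IZR (ys n) + 1) / (IZR (xs n) + 1))
      by (apply Rdiv_lt_0_compat; lra).
    (* With [a < a'] for the lower quotients and [b], [b'] for the upper ones, [b <= b'] would give
       [a * b <= a * b' < a' * b'], but both outer products are 1/10. *)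
    nra.
Qed.
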